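(* Let $(x^k)_{k\ge0}$ be the sequence generated by $\mathrm{HBA}(\mu,L)$ and let $\omega(x^0)$ be its set of accumulation points, $$\omega(x^0)=\{p\in\mathcal X:\ \exists\, k_q\uparrow\infty \text{ with } \lim_{q\to\infty}x^{k_q}=p\}.$$ Then $$\omega(x^0)\subseteq\{x\in\mathcal X:\ \exists\, y\in\mathbb R^m\ \text{ with }\ \nabla F_\mu(x)-A^\top y=0\}.$$
   Context: Problem data. $\mathcal C\subset\mathbb R^n$ is a nonempty open convex set containing no line; $A\in\mathbb R^{m\times n}$ has full row rank $m$, $b\in\mathbb R^m$; $\mathcal A=\{x:Ax=b\}$, $\mathcal X=\bar{\mathcal C}\cap\mathcal A$, $\mathcal X^\circ=\mathcal C\cap\mathcal A\ne\emptyset$. $f:\mathbb R^n\to(-\infty,+\infty]$ is proper, lower semicontinuous, finite and $C^1$ on $\mathcal C$, and all its level sets $\{x: f(x)\le r\}$, $r\in\mathbb R$, are bounded. Barrier-generating kernel. $M>0$, $\nu\in(2,4]$, and $h:\mathbb R^n\to(-\infty,+\infty]$ is a proper, closed (lower semicontinuous) convex function with effective domain $\operatorname{dom}h=\mathcal C$, $h\in C^3(\mathcal C)$, such that for all $x\in\mathcal C$, $u\in\mathbb R^n$, $v\in\mathbb R^n\setminus\{0\}$: $|\langle D^3h(x)[v]u,u\rangle|\le M\|u\|_x^2\|v\|_x^{\nu-2}\|v\|_2^{3-\nu}$, where $\|u\|_x=\sqrt{\langle H(x)u,u\rangle}$, $H(x)=\nabla^2h(x)$; if $\nu\in(3,4]$,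 moreover $h(x)\to\infty$ as $\|x\|\to\infty$. (Under these assumptions $H(x)$ is positive definite on $\mathcal C$.) $L$-smoothness. With $D_h(y,x)=h(y)-h(x)-\langle\nabla h(x),y-x\rangle$, there is $L>0$ with $f(y)-f(x)-\langle\nabla f(x),y-x\rangle\le L D_h(y,x)$ for all $x,y\in\mathcal C$. Algorithm. For $\mu>0$ let $F_\mu=f+\mu h$. For $x\in\mathcal X^\circ$ let $d_\mu(x)=\operatorname{argmin}_v\{\langle\nabla F_\mu(x),v\rangle+\frac12\|v\|_x^2: Av=0\}$, $\lambda_\mu(x)=\|d_\mu(x)\|_x$, $\beta_\mu(x)=\|d_\mu(x)\|_2$, $\delta_\mu(x)=M\frac{\nu-2}{2}\lambda_\mu(x)^{\nu-2}\beta_\mu(x)^{3-\nu}$ (and $\delta_\mu(x)=0$ if $d_\mu(x)=0$). The step size is, with $\delta=\delta_\mu(x)>0$, $$\alpha_\mu(x,L)=\begin{cases}\frac1\delta\Big[1-\big(1+\frac{\delta}{L+\mu}\frac{4-\nu}{\nu-2}\big)^{-\frac{\nu-2}{4-\nu}}\Big],&\nu\in(2,3)\cup(3,4),\\ \frac1{\delta+L+\mu},&\nu=3,\\ \frac1\delta\big[1-\exp(-\frac{\delta}{L+\mu})\big],&\nu=4,\end{cases}$$ and $\alpha_\mu(x,L)=1/(L+\mu)$ if $\delta_\mu(x)=0$. $\mathrm{HBA}(\mu,L)$ (run without stopping) generates $x^{k+1}=x^k+\alpha_\mu(x^k,L)d_\mu(x^k)$, $k\ge0$, where $x^0$ is a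 $\mathtt c$-analytic center ($\mathtt c>0$): $x^0\in\mathcal X^\circ$ and $h(x)\ge h(x^0)-\mathtt c$ for all $x\in\mathcal X$. *)

(* Defs.v *)
From HB Require Import structures.
From mathcomp Require Import all_boot all_order all_algebra.
From mathcomp Require Import all_classical all_reals all_analysis.

Set Implicit Arguments.
Unset Strict Implicit.
Unset Printing Implicit Defensive.

Import Order.TTheory GRing.Theory Num.Theory.
Import numFieldNormedType.Exports.

Local Open Scope classical_set_scope.
Local Open Scope ring_scope.

(* R^n is 'cV[R]_n. The library norm `|x| on matrices is the sup norm, so the
   Euclidean norm is defined separately; both induce the same topology and the
   same bounded sets. *)
Definition dotv (R : realType) n (u v : 'cV[R]_n) : R := (u^T *m v) 0 0.

Definition enorm (R : realType) n (u : 'cV[R]_n) : R := Num.sqrt (dotv u u).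

Definition evec (R : realType) n (i : 'I_n) : 'cV[R]_n := delta_mx i 0.

Definition no_line (R : realType) n (C : set 'cV[R]_n) : Prop :=
  ~ exists x v, v != 0 /\ forall t : R, C (x + t *: v).

Definition argmin (R : realType) (T : Type) (S : set T) (q : T -> R) : set T :=
  [set v | S v /\ forall w, S w -> q v <= q w].

(* C^k functions on an open set D *)
Fixpoint Ck (R : realType) n (k : nat) (D : set 'cV[R]_n) (g : 'cV[R]_n -> R)
    : Prop :=
  if k is k'.+1 then
    (forall x, D x -> differentiable g x) /\
    (forall v : 'cV[R]_n, Ck k' D ('D_v g))
  else forall x, D x -> {for x, continuous g}.

Section extended_real_valued.
Variables (R : realType) (n : nat).
Implicit Types (F : 'cV[R]_n -> \bar R) (x y u v : 'cV[R]_n).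

Definition proper F : Prop :=
  (forall x, F x != -oo%E) /\ exists x, (F x < +oo)%E.

Definition domain F : set 'cV[R]_n := [set x | (F x < +oo)%E].

Definition convex_efun F : Prop :=
  forall x y (t : R), 0 < t < 1 ->
    (F (t *: x + (1 - t) *: y)%R <= t%:E * F x + (1 - t)%:E * F y)%E.

Definition norm_coercive F : Prop :=
  forall r : R, exists K : R, forall x, K < enorm x -> (r%:E < F x)%E.

(* The derivatives below are those of the real-valued function fine \o F; they
   are meaningful at points in a neighbourhood of which F is finite. *)
Definition grad F x : 'cV[R]_n := \col_i 'D_(evec R i) (fine \o F) x.

Definition has_grad F x : Prop :=
  (\forall y \near x, F y \is a fin_num) /\ differentiable (fine \o F) x.

Definition hess F x : 'M[R]_n :=
  \matrix_(i, j) 'D_(evec R j) (fun z => grad F z i 0) x.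

(* D^3 F(x)[v], the derivative of the Hessian at x in the direction v *)
Definition third_diff F x v : 'M[R]_n :=
  \matrix_(i, j) 'D_v (fun z => hess F z i j) x.

Definition local_norm F x u : R := Num.sqrt (dotv (hess F x *m u) u).

(* D_F(y, x) *)
Definition bregman F y x : R :=
  fine (F y) - fine (F x) - dotv (grad F x) (y - x).

Definition generalized_self_concordant (C : set 'cV[R]_n) F (M nu : R) : Prop :=
  forall x u v, C x -> v != 0 ->
    `|dotv (third_diff F x v *m u) u| <=
      M * local_norm F x u ^+ 2 * local_norm F x v `^ (nu - 2)
        * enorm v `^ (3 - nu).

End extended_real_valued.

Section problem.
Variables (R : realType) (m n : nat).
Variables (C : set 'cV[R]_n) (A : 'M[R]_(m, n)) (b : 'cV[R]_m).

Definition affine_set : set 'cV[R]_n := [set x | A *m x = b].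

Definition feasible : set 'cV[R]_n := closure C `&` affine_set.

Definition strictly_feasible : set 'cV[R]_n := C `&` affine_set.

Record problem_data (f : 'cV[R]_n -> \bar R) : Prop := ProblemData {
  pb_nonempty : C !=set0;
  pb_open : open C;
  pb_convex : convex_set C;
  pb_no_line : no_line C;
  pb_rank : \rank A = m;
  pb_strictly_feasible : strictly_feasible !=set0;
  pb_proper : proper f;
  pb_lsc : lower_semicontinuous f;
  pb_finite : forall x, C x -> f x \is a fin_num;
  pb_C1 : Ck 1 C (fine \o f);
  pb_levels : forall r : R, bounded_set [set x | (f x <= r%:E)%E] }.

Record barrier_kernel (M nu : R) (h : 'cV[R]_n -> \bar R) : Prop :=
  BarrierKernel {
  bk_M : 0 < M;
  bk_nu : 2 < nu <= 4;
  bk_proper : proper h;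
  bk_lsc : lower_semicontinuous h;
  bk_convex : convex_efun h;
  bk_domain : domain h = C;
  bk_C3 : Ck 3 C (fine \o h);
  bk_gsc : generalized_self_concordant C h M nu;
  bk_coercive : 3 < nu -> norm_coercive h }.

Definition L_smooth (f h : 'cV[R]_n -> \bar R) (L : R) : Prop :=
  forall x y, C x -> C y -> bregman f y x <= L * bregman h y x.

Definition analytic_center (h : 'cV[R]_n -> \bar R) (c : R) (x0 : 'cV[R]_n)
    : Prop :=
  strictly_feasible x0 /\
  forall x, feasible x -> (h x0 - c%:E <= h x)%E.

End problem.

Section hba.
Variables (R : realType) (m n : nat) (A : 'M[R]_(m, n)).
Variables (f h : 'cV[R]_n -> \bar R) (M nu mu L : R).
Implicit Types x : 'cV[R]_n.

Definition potential x : \bar R := (f x + mu%:E * h x)%E.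

(* the minimizer; some arbitrary vector where no minimizer exists *)
Definition search_dir x : 'cV[R]_n :=
  get (argmin [set v | A *m v = 0]
    (fun v => dotv (grad potential x) v + 2^-1 * local_norm h x v ^+ 2)).

Definition newton_decrement x : R := local_norm h x (search_dir x).

Definition dir_norm x : R := enorm (search_dir x).

Definition delta_mu x : R :=
  if search_dir x == 0 then 0
  else M * ((nu - 2) / 2) * newton_decrement x `^ (nu - 2)
         * dir_norm x `^ (3 - nu).

Definition step_size x : R :=
  let d := delta_mu x in
  if d == 0 then (L + mu)^-1
  else if nu == 3 then (d + L + mu)^-1
  else if nu == 4 then d^-1 * (1 - expR (- (d / (L + mu))))
  else d^-1 * (1 - (1 + d / (L + mu) * ((4 - nu) / (nu - 2)))
                     `^ (- ((nu - 2) / (4 - nu)))).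

Definition hba_sequence (x : nat -> 'cV[R]_n) : Prop :=
  forall k, x k.+1 = x k + step_size (x k) *: search_dir (x k).

End hba.

Definition omega_limit (R : realType) n (X : set 'cV[R]_n)
    (x : nat -> 'cV[R]_n) : set 'cV[R]_n :=
  [set p | X p /\ exists k : nat -> nat,
     increasing_seq k /\ x \o k @ \oo --> p].

(* Main.v *)
(* For a direction [d] at [x], with local norm [lam], let [phi t] be the second
   derivative of [h] at [x + t d] in the direction [d].  Self-concordance reads
   [|phi'| <= c phi^(nu/2)].  If [phi 0 <= 0], uniqueness for this differential
   inequality keeps [phi <= 0], so [h] stays below its tangent and, being lower
   semicontinuous with open domain [C], is finite on a whole line, which is
   excluded; hence the Hessian is positive definite on [C].  Integrating the
   inequality for [phi^(-(nu-2)/2)] gives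
   [phi t <= lam^2 (1 - delta t)^(-2/(nu-2))].
   Now let [d] be the search direction.  The step size [a] is the point where the
   primitive of [(1 - delta t)^(-2/(nu-2))] vanishing at [0] equals [1/(L+mu)];
   as this primitive is convex, a step stays in [C] and decreases [F_mu] by at
   least [a lam^2 / 2].
   Along a subsequence converging to [p], lower semicontinuity puts [p] in [C].
   Near [p] the steps are bounded below, and if [p] were not stationary some [v]
   in the kernel of [A] would make the quadratic model negative at [p], so that
   [lam^2] would be bounded below near [p]; then [F_mu] would drop by a fixed
   amount at each visit near [p], contradicting its continuity at [p]. *)
Require Import Defs.
From HB Require Import structures.
From mathcomp Require Import all_boot all_order all_algebra.
From mathcomp Require Import all_classical all_reals all_analysis.
From mathcomp Require Import ring lra.

Set Implicit Arguments.
Unset Strict Implicit.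
Unset Printing Implicit Defensive.

Import Order.TTheory GRing.Theory Num.Theory.
Import numFieldNormedType.Exports.

Local Open Scope classical_set_scope.
Local Open Scope ring_scope.

(** * Linear algebra *)

Section euclidean.
Variables (R : realType).
Implicit Types (n m : nat).

Lemma dotvE n (u v : 'cV[R]_n) : dotv u v = \sum_i u i 0 * v i 0.
Proof. by rewrite /dotv mxE; apply: eq_bigr => i _; rewrite mxE. Qed.

Lemma dotvC n (u v : 'cV[R]_n) : dotv u v = dotv v u.
Proof. by rewrite !dotvE; apply: eq_bigr => i _; rewrite mulrC. Qed.

Lemma dotvDr n (u v w : 'cV[R]_n) : dotv u (v + w) = dotv u v + dotv u w.
Proof. by rewrite /dotv mulmxDr mxE. Qed.

Lemma dotvZr n (u v : 'cV[R]_n) a : dotv u (a *: v) = a * dotv u v.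
Proof. by rewrite /dotv -scalemxAr mxE. Qed.

Lemma dotvDl n (u v w : 'cV[R]_n) : dotv (u + v) w = dotv u w + dotv v w.
Proof. by rewrite dotvC dotvDr !(dotvC w). Qed.

Lemma dotvZl n (u v : 'cV[R]_n) a : dotv (a *: u) v = a * dotv u v.
Proof. by rewrite dotvC dotvZr dotvC. Qed.

Lemma dotv0 n (u : 'cV[R]_n) : dotv u 0 = 0.
Proof. by rewrite -(scale0r 0) dotvZr mul0r. Qed.

Lemma dotv_mulmx m n (B : 'M[R]_(m, n)) (u : 'cV[R]_n) (v : 'cV[R]_m) :
  dotv (B *m u) v = dotv u (B^T *m v).
Proof. by rewrite /dotv trmx_mul mulmxA. Qed.

Lemma dotvv_ge0 n (v : 'cV[R]_n) : 0 <= dotv v v.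
Proof. by rewrite dotvE sumr_ge0// => i _; rewrite -expr2 sqr_ge0. Qed.

Lemma sqr_enorm n (v : 'cV[R]_n) : enorm v ^+ 2 = dotv v v.
Proof. by rewrite sqr_sqrtr// dotvv_ge0. Qed.

Lemma sqr_coord_le n (v : 'cV[R]_n) i : v i 0 ^+ 2 <= enorm v ^+ 2.
Proof.
rewrite sqr_enorm dotvE (bigD1 i)//= -expr2 lerDl sumr_ge0// => j _.
by rewrite -expr2 sqr_ge0.
Qed.

Lemma coord_le_enorm n (v : 'cV[R]_n) i : `|v i 0| <= enorm v.
Proof.
rewrite -(@ler_pXn2r _ 2)// ?nnegrE ?sqrtr_ge0// real_normK ?num_real//.
exact: sqr_coord_le.
Qed.

Lemma enorm_eq0 n (v : 'cV[R]_n) : (enorm v == 0) = (v == 0).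
Proof.
apply/eqP/eqP => [v0|->]; last by rewrite /enorm dotv0 sqrtr0.
apply/colP => i; rewrite mxE; apply/eqP.
by rewrite -normr_le0 -v0 coord_le_enorm.
Qed.

Lemma enorm_gt0 n (v : 'cV[R]_n) : (0 < enorm v) = (v != 0).
Proof. by rewrite lt_def sqrtr_ge0 andbT enorm_eq0. Qed.

Lemma quad_le n (S : 'M[R]_n) (v : 'cV[R]_n) :
  `|dotv (S *m v) v| <= (\sum_i \sum_j `|S i j|) * enorm v ^+ 2.
Proof.
rewrite dotvE (le_trans (ler_norm_sum _ _ _))// mulr_suml ler_sum// => i _.
rewrite mxE mulr_suml (le_trans (ler_norm_sum _ _ _))// mulr_suml ler_sum// => j _.
rewrite !normrM -mulrA ler_wpM2l// expr2 ler_pM//; exact: coord_le_enorm.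
Qed.

(** The columns of [cokermx A] lie in the kernel of [A], so [g^T] annihilates them and therefore
    belongs to the row space of [A]. *)
Lemma dotv_ker_range m n (A : 'M[R]_(m, n)) (g : 'cV[R]_n) :
  (forall v, A *m v = 0 -> dotv g v = 0) -> exists y, g - A^T *m y = 0.
Proof.
move=> gA; have /submxP[D gD] : (g^T <= A)%MS.
  rewrite submxE; apply/eqP/rowP => j; rewrite [RHS]mxE.
  have /gA : A *m col j (cokermx A) = 0 by rewrite colE mulmxA mulmx_coker mul0mx.
  by rewrite /dotv colE mulmxA -colE mxE.
by exists D^T; rewrite -trmx_mul -gD trmxK subrr.
Qed.

(** [S] may be nonsymmetric: the Hessian enters as a matrix of iterated partial derivatives, whose
    symmetry is not proved. Where a symmetric form is wanted, [S + S^T] is used; it has twice the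
    same quadratic form. *)
Definition posdef n (S : 'M[R]_n) := forall v : 'cV[R]_n, v != 0 -> 0 < dotv (S *m v) v.

Lemma posdef_unitmx n (S : 'M[R]_n) : posdef S -> S \in unitmx.
Proof.
move=> S0; rewrite -unitmx_tr -row_free_unit -kermx_eq0; apply/eqP/row_matrixP => i.
rewrite row0; apply: contrapT => /eqP k0.
have Sk : S *m (row i (kermx S^T))^T = 0.
  by apply: trmx_inj; rewrite trmx_mul trmxK -row_mul mulmx_ker row0 trmx0.
have k0' : (row i (kermx S^T))^T != 0.
  by apply: contra k0 => /eqP/(congr1 trmx); rewrite trmxK trmx0 => ->.
by have := S0 _ k0'; rewrite Sk dotvC dotv0 ltxx.
Qed.

(** An algebraic substitute for compactness of the unit sphere: each squared coordinate of [v] is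
    bounded by a multiple of the form, and these bounds are summed. *)
Lemma posdef_coercive n (S : 'M[R]_n) : posdef S ->
  exists2 K, 0 < K & forall v : 'cV[R]_n, enorm v ^+ 2 <= K * dotv (S *m v) v.
Proof.
move=> S0; pose T := S + S^T.
have TE (u w : 'cV[R]_n) : dotv (T *m u) w = dotv (S *m u) w + dotv (S *m w) u.
  by rewrite mulmxDl dotvDl; congr (_ + _); rewrite dotv_mulmx trmxK dotvC.
have TT (u : 'cV[R]_n) : dotv (T *m u) u = 2 * dotv (S *m u) u by rewrite TE; ring.
have T0 : posdef T by move=> v v0; rewrite TT mulr_gt0// S0.
have Tu := posdef_unitmx T0.
pose w i := invmx T *m evec R i.
have wi v i : dotv (T *m w i) v = v i 0.
  rewrite mulmxA mulmxV// mul1mx dotvE (bigD1 i)//= big1 ?addr0; last first.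
    by move=> j ji; rewrite mxE eqxx andbT (negPf ji) mul0r.
  by rewrite mxE !eqxx mul1r.
have wS i : 0 < dotv (T *m w i) (w i).
  apply: T0; apply/negP => /eqP w0.
  have := wi (evec R i) i; rewrite w0 mulmx0 dotvC dotv0 mxE !eqxx => /eqP.
  by rewrite eq_sym oner_eq0.
(* Cauchy-Schwarz for the inner product of T, as [v_i = <T w_i, v>] *)
have CS (v : 'cV[R]_n) i : v i 0 ^+ 2 <= dotv (T *m w i) (w i) * dotv (T *m v) v.
  (* This [s] minimises the form of [T] at [v - s *: w i]; nonnegativity at the minimum is the
     bound. *)
  set c := dotv (T *m w i) (w i); pose s := v i 0 / c.
  have c0 : 0 < c := wS i.
  have : 0 <= dotv (T *m (v - s *: w i)) (v - s *: w i).
    have [->|/T0/ltW//] := eqVneq (v - s *: w i) 0.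
    by rewrite dotv0.
  rewrite -scaleNr mulmxDr -scalemxAr !(dotvDl, dotvDr, dotvZl, dotvZr) -/c.
  have -> : dotv (T *m v) (w i) = v i 0.
    by rewrite -wi !TE addrC.
  rewrite wi.
  have -> : dotv (T *m v) v + - s * v i 0 + (- s * v i 0 + - s * (- s * c))
     = (c * dotv (T *m v) v - v i 0 ^+ 2) / c.
    by rewrite /s; field; rewrite gt_eqF.
  by rewrite pmulr_lge0 ?invr_gt0// subr_ge0.
(* The summand 1 keeps the constant positive when [n = 0]; the factor 2 comes from [TT]. *)
exists (1 + 2 * \sum_i dotv (T *m w i) (w i)).
  by rewrite ltr_wpDr// mulr_ge0// sumr_ge0// => i _; rewrite ltW.
move=> v; have Sv : 0 <= dotv (S *m v) v.
  by have [->|/S0/ltW//] := eqVneq v 0; rewrite dotv0.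
rewrite mulrDl mul1r -[leLHS]add0r lerD// mulrAC -TT mulrC mulr_suml.
by rewrite sqr_enorm dotvE ler_sum// => i _; rewrite -expr2 CS.
Qed.

(** Replacing [S] by [T] costs at most half of [enorm v ^+ 2], which is absorbed on the left; hence
    the doubled constant. *)
Lemma coercive_perturbation n (S T : 'M[R]_n) K (v : 'cV[R]_n) : 0 < K ->
  enorm v ^+ 2 <= K * dotv (S *m v) v ->
  \sum_i \sum_j `|S i j - T i j| <= (2 * K)^-1 ->
  enorm v ^+ 2 <= 2 * K * dotv (T *m v) v.
Proof.
move=> K0 Sv ST.
have H : dotv ((S - T) *m v) v <= (2 * K)^-1 * enorm v ^+ 2.
  apply: (le_trans (ler_norm _)); apply: (le_trans (quad_le _ _)).
  rewrite ler_wpM2r ?sqr_ge0// (le_trans _ ST)// ler_sum// => i _.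
  by rewrite ler_sum// => j _; rewrite !mxE.
rewrite mulmxBl dotvDl -scaleN1r dotvZl mulN1r lerBlDr in H.
have := le_trans Sv (ler_wpM2l (ltW K0) H).
rewrite mulrDr mulrA (_ : K * (2 * K)^-1 = 2^-1); last by field; rewrite gt_eqF.
lra.
Qed.

(** The columns of [B] form a basis of the kernel of [A]. The critical point of the model reduced to
    these coordinates exists because the reduced matrix is invertible, and moving from it by [w] in
    the kernel changes the model by half of [dotv (S *m w) w]. *)
Lemma posdef_argmin m n (A : 'M[R]_(m, n)) (S : 'M[R]_n) (g : 'cV[R]_n) :
  posdef S -> (argmin [set v | A *m v = 0]
    (fun v => dotv g v + 2^-1 * dotv (S *m v) v)) !=set0.
Proof.
move=> S0; pose T := S + S^T.
have TE (u w : 'cV[R]_n) : dotv (T *m u) w = dotv (S *m u) w + dotv (S *m w) u.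
  by rewrite mulmxDl dotvDl; congr (_ + _); rewrite dotv_mulmx trmxK dotvC.
pose B := (row_base (kermx A^T))^T.
have AB : A *m B = 0.
  apply: trmx_inj; rewrite trmx_mul trmxK trmx0; apply/eqP.
  by rewrite -sub_kermx eq_row_base.
have kerB (v : 'cV[R]_n) : A *m v = 0 -> exists z, v = B *m z.
  move=> Av; have /submxP[D vD] : (v^T <= row_base (kermx A^T))%MS.
    by rewrite eq_row_base sub_kermx -trmx_mul Av trmx0.
  by exists D^T; rewrite -trmx_mul -vD trmxK.
have B0 z : B *m z = 0 -> z = 0.
  move=> Bz; apply: trmx_inj; rewrite trmx0.
  apply: (row_free_inj (row_base_free (kermx A^T))).
  by rewrite mul0mx; apply: trmx_inj; rewrite trmx_mul trmxK trmx0.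
have Gu : B^T *m T *m B \in unitmx.
  apply: posdef_unitmx => z z0.
  rewrite -!mulmxA dotv_mulmx trmxK TE addr_gt0 ?S0//;
    by apply: contra z0 => /eqP/B0 ->.
(* The gradient of the model at [d] is [g + 2^-1 *: (T *m d)]; this [d] makes it orthogonal to the
   kernel of [A]. *)
pose d := B *m (invmx (B^T *m T *m B) *m (B^T *m (- (2 *: g)))).
have dg w : A *m w = 0 -> dotv g w + 2^-1 * dotv (T *m d) w = 0.
  move=> /kerB[z ->]; rewrite ![dotv _ (B *m z)]dotvC !dotv_mulmx.
  have -> : B^T *m (T *m d) = B^T *m (- (2 *: g)).
    by rewrite /d !mulmxA mulmxV ?mul1mx.
  rewrite -dotvZr -dotvDr scalemxAr -mulmxDr scalerN scalerA mulVf// scale1r subrr.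
  by rewrite mulmx0 dotv0.
exists d; split => /= [|v Av]; first by rewrite /d mulmxA AB mul0mx.
have Aw : A *m (v - d) = 0.
  by rewrite mulmxBr Av /d mulmxA AB mul0mx subr0.
have -> : v = d + (v - d) by rewrite addrC subrK.
move: (v - d) Aw => w Aw.
rewrite mulmxDr !(dotvDl, dotvDr).
have := dg _ Aw; rewrite TE => e.
have : 0 <= dotv (S *m w) w.
  by have [->|/S0/ltW//] := eqVneq w 0; rewrite dotv0.
lra.
Qed.

End euclidean.

(** * Calculus along lines *)

Section calculus.
Variable R : realType.

Lemma le0_is_derive_le (g dg : R -> R) (a b : R) : a <= b ->
  (forall s, a <= s <= b -> is_derive s 1 g (dg s)) ->
  (forall s, a < s < b -> dg s <= 0) -> g b <= g a.
Proof.
move=> ab gd dg0; have gc : {within `[a, b], continuous g}.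
  by apply: derivable_within_continuous => s; rewrite in_itv/= => /gd[].
move: ab; rewrite le_eqVlt => /predU1P[->//|ab].
have [s|s] := @MVT _ g dg _ _ ab _ gc.
  by rewrite in_itv/= => /andP[? ?]; apply: gd; rewrite !ltW.
rewrite in_itv/= => sab e; rewrite -subr_le0 e mulr_le0_ge0// ?dg0//.
by rewrite subr_ge0 ltW.
Qed.

(** The increments agree near [x], so the first-order expansion of [f] is also one of [g]. This
    serves for [fine] of an extended real sum, which splits only where both terms are finite. *)
Lemma near_eq_differentiable (V W : normedModType R) (f g : V -> W) (x : V) :
  (\near x, f x = g x) -> differentiable f x -> differentiable g x.
Proof.
move=> fg /diff_locallyP[dc /eqaddoP de].
have sx : y + x @[y --> (0 : V)] --> x.
  rewrite -[X in _ --> X]add0r.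
  by apply: cvgD; [exact: cvg_id|exact: cvg_cst].
have ge : g \o shift x = cst (g x) + 'd f x +o_ 0 id.
  have fgx : \forall y \near (0 : V), f (y + x) = g (y + x) := sx _ fg.
  apply/eqaddoP => e e0; near=> y.
  have -> : ((g \o shift x) - (cst (g x) + 'd f x)) y =
            ((f \o shift x) - (cst (f x) + 'd f x)) y.
    by rewrite !fctE /= (nbhs_singleton fg) (near fgx).
  by near: y; exact: de.
by apply/diff_locallyP; rewrite (diff_unique dc ge); split.
Unshelve. all: by end_near. Qed.

Lemma is_derive_line n (g : 'cV[R]_n -> R) (x v : 'cV[R]_n) (t : R) :
  differentiable g (x + t *: v) ->
  is_derive t 1 (fun s => g (x + s *: v)) ('D_v g (x + t *: v)).
Proof.
move=> gd; have := derivableP (@diff_derivable _ _ _ _ _ v gd).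
have e : (fun s : R => s^-1 *: (g (s *: v + (x + t *: v)) - g (x + t *: v))) =
  (fun s => s^-1 *: (g (x + (s *: (1 : R) + t) *: v) - g (x + t *: v))).
  apply/funext => s; congr (_ *: (g _ - _)).
  by rewrite [s *: 1]mulr1 scalerDl addrCA.
by move=> [d1 d2]; apply: DeriveDef; rewrite /derivable /derive -e.
Qed.

Lemma derive_dotv n (g : 'cV[R]_n -> R) (x v : 'cV[R]_n) :
  differentiable g x ->
  'D_v g x = dotv (\col_i 'D_(evec R i) g x) v.
Proof.
move=> gd; rewrite deriveE//.
have {1}-> : v = \sum_i v i 0 *: evec R i.
  rewrite {1}(matrix_sum_delta v); apply: eq_bigr => i _.
  by rewrite big_ord_recl big_ord0 addr0.
rewrite linear_sum dotvE; apply: eq_bigr => i _.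
by rewrite linearZ/= mxE deriveE// mulrC.
Qed.

Lemma continuous_line n (x v : 'cV[R]_n) : continuous (fun t : R => x + t *: v).
Proof. by move=> t; apply: cvgD; [exact: cvg_cst|exact: scalel_continuous]. Qed.

Lemma convex_line n (C : set 'cV[R]_n) (x v : 'cV[R]_n) (s t : R) :
  convex_set C -> C x -> C (x + t *: v) -> 0 <= s <= t -> C (x + s *: v).
Proof.
move=> Cc Cx Ct /andP[s0 st].
have [t0|t0] := eqVneq t 0.
  have -> : s = 0 by apply/le_anti; rewrite s0 -t0 st.
  by rewrite scale0r addr0.
have tp : 0 < t by rewrite lt_def t0 (le_trans s0).
have k0 : 0 <= s / t by rewrite divr_ge0// ltW.
have k1 : s / t <= 1 by rewrite ler_pdivrMr// mul1r.
have <- : (s / t) *: (x + t *: v) + (1 - s / t) *: x = x + s *: v.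
  by rewrite scalerDr addrAC -scalerDl scalerA divfK// subrKC scale1r.
exact/set_mem/(Cc _ _ (Itv01 k0 k1) (mem_set Ct) (mem_set Cx)).
Qed.

(* [t |-> x + t *: v] enters [C] on a set that is open by openness of [C] and
   closed by lower semicontinuity, as it is the set where [F] is at most [B] *)
Lemma stay_in_domain n (C : set 'cV[R]_n) (F : 'cV[R]_n -> \bar R)
    (x v : 'cV[R]_n) (T B : R) :
  open C -> domain F = C -> lower_semicontinuous F -> C x -> 0 <= T ->
  (forall t, 0 <= t <= T -> C (x + t *: v) -> (F (x + t *: v)%R <= B%:E)%E) ->
  C (x + T *: v).
Proof.
move=> oC dF lF Cx T0 FB.
have lc := @continuous_line _ x v.
suff : `[0, T]%classic `&` [set t | C (x + t *: v)] = `[0, T]%classic.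
  by move/seteqP => [_ /(_ T)]; rewrite /= in_itv/= T0 lexx => /(_ isT)[].
apply: (segment_connected (a := 0) (b := T)).
- by exists 0; split => /=; rewrite ?in_itv/= ?lexx// scale0r addr0.
- exists [set t | C (x + t *: v)] => //.
  by apply: (@open_comp _ _ (fun t : R => x + t *: v)) => // t _; exact: lc.
exists [set t | (F (x + t *: v)%R <= B%:E)%E].
  rewrite -openC (_ : ~` _ = (fun t : R => x + t *: v) @^-1` [set y | (B%:E < F y)%E]).
    by apply: open_comp => [t _|]; [exact: lc|move/lower_semicontinuousP : lF; exact].
  by apply/seteqP; split => t /=; rewrite ltNge => /negP.
apply/seteqP; split => t /= [t0 Ht]; split => //.
  by apply: FB => //; rewrite in_itv/= in t0.
by rewrite -dF /domain/= (le_lt_trans Ht)// ltry.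
Qed.

End calculus.

(** * Comparison for self-concordant functions of one variable *)

Section comparison.
Variable R : realType.

Lemma ge0_powRK (y p : R) : 0 <= y -> p != 0 -> (y `^ p) `^ p^-1 = y.
Proof. by move=> y0 p0; rewrite -powRrM divff// powRr1. Qed.

Lemma sqrt_powR (y p : R) : 0 <= y -> Num.sqrt y `^ p = y `^ (p / 2).
Proof. by move=> y0; rewrite -powR12_sqrt// -powRrM mulrC. Qed.

Lemma ge0_le_powRN (y z p : R) : 0 < y -> y <= z -> 0 <= p -> z `^ (- p) <= y `^ (- p).
Proof.
move=> y0 yz p0; have z0 := lt_le_trans y0 yz.
rewrite !powRN lef_pV2 ?posrE ?powR_gt0// ge0_ler_powR// nnegrE ltW//.
Qed.

Section ode.
Variables (phi dphi : R -> R) (c q T : R).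
Hypotheses (T0 : 0 <= T) (c0 : 0 <= c) (q0 : 0 < q).
Hypothesis phi' : forall s, 0 <= s <= T -> is_derive s 1 phi (dphi s).
(** [Num.sqrt] vanishes on negative reals, so the bound forces [dphi s = 0] where [phi s <= 0];
    where [phi] is positive it reads [|phi'| <= c phi^(1 + q/2)]. *)
Hypothesis dphi_le : forall s, 0 <= s <= T ->
  `|dphi s| <= c * Num.sqrt (phi s) ^+ 2 * Num.sqrt (phi s) `^ q.

(* [(phi - phi 0) ^+ 2] satisfies a linear differential inequality with zero
   initial value, so [phi] is constant. *)
Lemma nonpositive_preserved : phi 0 <= 0 -> phi T <= 0.
Proof.
move=> phi0.
have [B phiB] : exists B, forall s, 0 <= s <= T -> phi s <= B.
  have [|b _ bM] := @EVT_max R phi 0 T T0.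
    by apply: derivable_within_continuous => s; rewrite in_itv/= => /phi'[].
  by exists (phi b) => s s0; apply: bM; rewrite in_itv.
(* Bounding [phi] by [B] makes the inequality linear with rate [k]; [g] carries the integrating
   factor of Gronwall's argument. *)
pose k := 2 * c * Num.sqrt B `^ q.
pose g s := (phi s - phi 0) ^+ 2 * expR (- (k * s)).
pose dg s := (2 * (phi s - phi 0) * dphi s - k * (phi s - phi 0) ^+ 2) * expR (- (k * s)).
have g' s : 0 <= s <= T -> is_derive s 1 g (dg s).
  move=> sT; have p1 := is_deriveB (phi' sT) (is_derive_cst (phi 0) s 1).
  have p2 : is_derive s 1 (fun s => - (k * s)) (- k).
    apply: is_derive_eq (is_deriveN (is_deriveZ k (is_derive_id s 1))) _.
    by rewrite /GRing.scale/= mulr1.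
  have p3 := @is_derive1_comp R expR (fun s => - (k * s)) s _ _ (is_derive_expR _) p2.
  have p4 : is_derive s 1 g _ := is_deriveM (is_deriveX 2 p1) p3.
  apply: is_derive_eq p4 _.
  rewrite /dg /GRing.scale/= !fctE. ring.
have dg0 s : 0 < s < T -> dg s <= 0.
  move=> /andP[/ltW s0 /ltW sT]; have s0T : 0 <= s <= T by rewrite s0.
  rewrite /dg mulr_le0_ge0 ?expR_ge0// subr_le0.
  apply: (le_trans (ler_norm _)).
  rewrite !normrM (ger0_norm (_ : 0 <= 2 :> R))// /k -!mulrA ler_pM2l//.
  have := dphi_le s0T; set w := Num.sqrt (phi s) => H.
  have H2 : `|dphi s| <= c * Num.sqrt B `^ q * w ^+ 2.
    apply: (le_trans H); rewrite mulrAC ler_wpM2r ?sqr_ge0// ler_wpM2l//.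
    by rewrite ge0_ler_powR ?nnegrE ?sqrtr_ge0 ?(ltW q0)// ler_wsqrtr ?phiB.
  (* The sign of [phi 0] enters here: [w ^+ 2] is the positive part of [phi s]. *)
  have H3 : w ^+ 2 <= `|phi s - phi 0|.
    have [p0|p0] := leP 0 (phi s).
      by rewrite sqr_sqrtr// (le_trans _ (ler_norm _))// lerBrDr gerDl.
    rewrite /w ler0_sqrtr ?(ltW p0)// expr0n. exact: normr_ge0.
  rewrite -(real_normK (num_real (phi s - phi 0))).
  apply: (le_trans (ler_wpM2l (normr_ge0 _) H2)).
  rewrite [leRHS](_ : _ = `|phi s - phi 0| *
    (c * Num.sqrt B `^ q * `|phi s - phi 0|)); last by ring.
  by rewrite !ler_wpM2l// mulr_ge0 ?powR_ge0.
have := le0_is_derive_le T0 g' dg0.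
rewrite /g subrr expr0n/= mul0r => H.
have : (phi T - phi 0) ^+ 2 <= 0 by move: H; rewrite pmulr_lle0 ?expR_gt0.
by rewrite exprn_even_le0//= subr_eq0 => /eqP ->.
Qed.

(** With [r = q/2], the derivative of [phi^(-r)] is at least [- r c], so [phi^(-r)] at [T] is at
    least [phi(0)^(-r) (1 - d T)]; raising to the power [-1/r] reverses the inequality. *)
Lemma positive_growth d : d = c * (q / 2) * Num.sqrt (phi 0) `^ q ->
  (forall s, 0 <= s <= T -> 0 < phi s) -> d * T < 1 ->
  phi T <= phi 0 * (1 - d * T) `^ (- (2 / q)).
Proof.
move=> dE phi_gt0 dT; set r := q / 2.
have r0 : 0 < r by rewrite divr_gt0.
have phi0 : 0 < phi 0 by apply: phi_gt0; rewrite lexx.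
pose g s := - phi s `^ (- r) - r * c * s.
pose dg s := r * phi s `^ (- r - 1) * dphi s - r * c.
have g' s : 0 <= s <= T -> is_derive s 1 g (dg s).
  move=> sT; have p0 := phi_gt0 _ sT.
  have p1 := @is_derive1_comp R _ phi s _ _ (is_derive1_powR (- r) p0) (phi' sT).
  have p2 : is_derive s 1 g _ :=
    is_deriveB (is_deriveN p1) (is_deriveZ (r * c) (is_derive_id s 1)).
  apply: is_derive_eq p2 _.
  rewrite /dg /GRing.scale/=; ring.
have dg0 s : 0 < s < T -> dg s <= 0.
  move=> /andP[/ltW s0 /ltW sT]; have s0T : 0 <= s <= T by rewrite s0.
  have p0 := phi_gt0 _ s0T.
  rewrite /dg subr_le0 -mulrA ler_pM2l//.
  apply: (le_trans (ler_norm _)); rewrite normrM (ger0_norm (powR_ge0 _ _)).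
  apply: (@le_trans _ _ (phi s `^ (- r - 1) * (c * phi s * phi s `^ r))).
    rewrite ler_wpM2l ?powR_ge0// (le_trans (dphi_le s0T))// sqr_sqrtr ?(ltW p0)//.
    by rewrite sqrt_powR ?(ltW p0).
  rewrite -[X in c * X]powRr1 ?(ltW p0)// -mulrA -powRD ?(gt_eqF p0) ?implybT//.
  rewrite mulrCA -powRD ?(gt_eqF p0) ?implybT//.
  by rewrite (_ : - r - 1 + _ = 0) ?powRr0 ?mulr1//; ring.
have := le0_is_derive_le T0 g' dg0; rewrite /g mulr0 subr0.
have pT : 0 < phi T by apply: phi_gt0; rewrite T0 lexx.
move=> H.
have {H}H : phi 0 `^ (- r) * (1 - d * T) <= phi T `^ (- r).
  suff -> : phi 0 `^ (- r) * (1 - d * T) = phi 0 `^ (- r) - r * c * T by lra.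
  rewrite mulrBr mulr1 dE sqrt_powR ?ltW// -/r; congr (_ - _).
  rewrite powRN; field.
  by rewrite gt_eqF// powR_gt0.
have dT0 : 0 < 1 - d * T by rewrite subr_gt0.
have rN : - r != 0 by rewrite oppr_eq0 gt_eqF.
have -> : phi T = (phi T `^ (- r)) `^ (- r^-1).
  by rewrite -invrN ge0_powRK ?(ltW pT).
have H2 : 0 < phi 0 `^ (- r) * (1 - d * T) by rewrite mulr_gt0 ?powR_gt0.
apply: (le_trans (ge0_le_powRN H2 H _)); first by rewrite invr_ge0 ltW.
rewrite powRM ?powR_ge0 ?(ltW dT0)// -invrN ge0_powRK ?(ltW phi0)//.
by rewrite invrN /r invf_div.
Qed.

End ode.
End comparison.

(** * The step size *)

Section step.
Variable R : realType.

(** The common description of all branches of the step size [a]: [psi] is the primitive of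
    [(1 - d s)^(-p)] vanishing at 0, and it reaches [1/K] at [a]. It is applied with
    [p = 2/(nu - 2)], [K = L + mu] and [d] equal to delta. *)
Definition step_profile (p K d a : R) (psi : R -> R) :=
  [/\ psi 0 = 0, psi a = K^-1 &
    forall s, 0 <= s <= a -> is_derive s 1 psi ((1 - d * s) `^ (- p))].

Lemma step_profile_MVT (p K d a : R) psi s t : step_profile p K d a psi ->
  0 <= s -> s <= t -> t <= a ->
  exists2 c, s <= c <= t & psi t - psi s = (1 - d * c) `^ (- p) * (t - s).
Proof.
move=> [_ _ psi'] s0 st ta.
have d1 r : s <= r <= t -> is_derive r 1 psi ((1 - d * r) `^ (- p)).
  by move=> /andP[sr rt]; apply: psi'; rewrite (le_trans s0)// (le_trans rt).
have gc : {within `[s, t], continuous psi}.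
  by apply: derivable_within_continuous => r; rewrite in_itv/= => /d1[].
have [r|c cst e] := @MVT_segment _ psi (fun c => (1 - d * c) `^ (- p)) _ _ st _ gc.
  by rewrite in_itv/= => /andP[? ?]; apply: d1; rewrite !ltW.
by exists c => //; move: cst; rewrite in_itv.
Qed.

(* [psi] is convex *)
Lemma step_profile_le (p K d a : R) psi t : step_profile p K d a psi ->
  0 <= p -> 0 <= d -> d * a < 1 -> 0 < a -> 0 <= t <= a -> psi t <= t / (a * K).
Proof.
move=> prof p0 d0 da a0 /andP[t0 ta].
have [psi0 psia _] := prof.
have [c1 /andP[_ c1t] e1] := step_profile_MVT prof (lexx 0) t0 ta.
have [c2 /andP[tc2 c2a] e2] := step_profile_MVT prof t0 ta (lexx a).
have H : (1 - d * c1) `^ (- p) <= (1 - d * c2) `^ (- p).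
  apply: ge0_le_powRN => //.
    by rewrite subr_gt0 (le_lt_trans _ da)// ler_wpM2l.
  by rewrite lerD2l lerN2 ler_wpM2l// (le_trans c1t).
rewrite psi0 !subr0 in e1.
have -> : t / (a * K) = psi a * t / a by rewrite invfM psia; ring.
rewrite ler_pdivlMr// -subr_ge0.
have -> : psi a = psi t + (1 - d * c2) `^ (- p) * (a - t) by rewrite -e2 subrKC.
rewrite e1.
rewrite [leRHS](_ : _ = (a - t) * t *
  ((1 - d * c2) `^ (- p) - (1 - d * c1) `^ (- p))); last by ring.
by rewrite !mulr_ge0// subr_ge0.
Qed.

(** If [a] is below [1/(2D)], then [d s <= 1/2] on [[0, a]], the integrand is at most [2^p], and
    [1/K = psi a <= 2^p a]. *)
Lemma step_profile_lower_bound (p K d a : R) psi D : step_profile p K d a psi ->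
  0 < K -> 0 <= p -> 0 < a -> 0 <= d <= D -> 0 < D ->
  Num.min (2 * D)^-1 (K * 2 `^ p)^-1 <= a.
Proof.
move=> prof K0 p0 a0 /andP[d0 dD] D0; rewrite ge_min.
have [//|aD/=] := leP (2 * D)^-1 a.
have [psi0 psia _] := prof.
have [c /andP[c0 ca] ] := step_profile_MVT prof (lexx 0) (ltW a0) (lexx a).
rewrite psi0 psia !subr0 => e.
have dc : d * c <= 2^-1.
  apply: (@le_trans _ _ (D * (2 * D)^-1)).
    by rewrite ler_pM// (le_trans ca)// ltW.
  by rewrite invfM mulrCA divff ?mulr1 ?gt_eqF.
rewrite invfM e mulrAC -[leRHS]mul1r ler_wpM2r ?(ltW a0)//.
rewrite ler_pdivrMr ?powR_gt0// mul1r.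
have -> : 2 `^ p = (2^-1) `^ (- p) :> R.
  by rewrite -[2^-1]powR_inv1// -powRrM mulN1r opprK.
by apply: ge0_le_powRN => //; lra.
Qed.

Section step_size.
Variables (m n : nat) (A : 'M[R]_(m, n)) (f h : 'cV[R]_n -> \bar R).
Variables (M nu mu L : R) (x : 'cV[R]_n).
Hypotheses (M0 : 0 < M) (nu24 : 2 < nu <= 4) (mu0 : 0 < mu) (L0 : 0 < L).

Let nu2 : 0 < nu - 2. Proof. by rewrite subr_gt0; case/andP: nu24. Qed.

Lemma delta_mu_ge0 : 0 <= delta_mu A f h M nu mu x.
Proof.
rewrite /delta_mu; case: ifP => // _.
by rewrite !mulr_ge0 ?powR_ge0 ?invr_ge0 ?ltW.
Qed.

(** Each branch solves [psi a = 1/(L + mu)] for an explicit primitive: the identity for delta zero,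
    a logarithm for [nu = 4], a power otherwise. The bound [d * a < 1] keeps the base [1 - d s]
    positive up to [a]. *)
Lemma step_size_profile (d := delta_mu A f h M nu mu x)
    (a := step_size A f h M nu mu L x) :
  [/\ 0 < a, d * a < 1 &
    exists psi, step_profile (2 / (nu - 2)) (L + mu) d a psi].
Proof.
have K0 : 0 < L + mu by rewrite addr_gt0.
rewrite {}/a /step_size -/d; have d0 : 0 <= d by exact: delta_mu_ge0.
case: ifPn => [/eqP ->|dN0].
  split; rewrite ?invr_gt0 ?mul0r//; exists id; split => // s _.
  by apply: is_derive_eq (is_derive_id s 1) _; rewrite mul0r subr0 powR1.
have {d0}d0 : 0 < d by rewrite lt_def dN0.
have lin (s : R) : is_derive s 1 (fun s => 1 - d * s) (- d).
  have := is_deriveB (is_derive_cst (1 : R) s 1) (is_deriveZ d (is_derive_id s 1)).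
  by rewrite /GRing.scale/= sub0r mulr1.
have [nu4|nuN4] := eqVneq nu 4.
  rewrite nu4 !eqr_nat/=.
  have da : d * (d^-1 * (1 - expR (- (d / (L + mu))))) < 1.
    by rewrite mulVKf// gtrBl expR_gt0.
  split=> //.
    rewrite mulr_gt0 ?invr_gt0// subr_gt0.
    by rewrite -[ltRHS]expR0 ltr_expR oppr_lt0 divr_gt0.
  exists (fun s => - d^-1 * ln (1 - d * s)); split.
  - by rewrite mulr0 subr0 ln1 mulr0.
  - by rewrite mulVKf// opprB addrCA subrr addr0 expRK mulrNN mulKf.
  move=> s /andP[s0 sa].
  have s1 : 0 < 1 - d * s.
    by rewrite subr_gt0 (le_lt_trans _ da)// ler_wpM2l// ltW.
  have H := @is_derive1_comp R (@ln R) (fun s => 1 - d * s) s _ _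
    (is_derive1_ln s1) (lin s).
  apply: is_derive_eq (is_deriveZ (- d^-1) H) _.
  rewrite (_ : 2 / (4 - 2) = 1); last by field.
  rewrite powR_inv1 ?(ltW s1)// /GRing.scale/=; field.
  by rewrite dN0 gt_eqF.
have nu4 : nu < 4 by rewrite lt_def eq_sym nuN4; case/andP: nu24.
(* The exponent satisfies [2/(nu - 2) = r + 1], so integration yields the power [-r]. *)
pose r := (4 - nu) / (nu - 2).
have r0 : 0 < r by rewrite divr_gt0// subr_gt0.
pose u := 1 + d / (L + mu) * r.
have u1 : 1 < u by rewrite ltrDl mulr_gt0// divr_gt0.
have u0 : 0 < u by rewrite (lt_trans _ u1).
(* The branch [nu = 3] is the general formula at [r = 1]. *)
have -> : (if nu == 3 then (d + L + mu)^-1 else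
   d^-1 * (1 - (1 + d / (L + mu) * ((4 - nu) / (nu - 2))) `^ (- ((nu - 2) / (4 - nu))))) =
   d^-1 * (1 - u `^ (- r^-1)).
  case: ifPn => [/eqP nu3|_]; last by rewrite /u /r invf_div.
  have r1 : r = 1 by rewrite /r nu3; field.
  rewrite r1 invr1 powR_inv1 ?(ltW u0)// /u r1; field.
  by rewrite dN0 !gt_eqF//; lra.
have ur : 0 < u `^ (- r^-1) by rewrite powR_gt0.
have da : d * (d^-1 * (1 - u `^ (- r^-1))) < 1 by rewrite mulVKf// gtrBl.
split=> //.
  have u1r : 1 < u `^ r^-1.
    rewrite -[ltLHS](_ : 1 `^ r^-1 = 1); last by rewrite powR1.
    by rewrite gt0_ltr_powR ?nnegrE ?invr_gt0 ?(ltW u0).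
  by rewrite mulr_gt0 ?invr_gt0// subr_gt0 powRN invf_lt1 ?powR_gt0.
exists (fun s => (d * r)^-1 * ((1 - d * s) `^ (- r) - 1)); split.
- by rewrite mulr0 subr0 powR1 subrr mulr0.
- rewrite mulVKf// opprB addrCA subrr addr0 -powRrM mulrNN mulVf ?gt_eqF//.
  rewrite powRr1 ?(ltW u0)// /u addrAC subrr add0r; field.
  by rewrite dN0 !gt_eqF.
move=> s /andP[s0 sa].
have s1 : 0 < 1 - d * s.
  by rewrite subr_gt0 (le_lt_trans _ da)// ler_wpM2l// ltW.
have H := @is_derive1_comp R _ (fun s => 1 - d * s) s _ _
  (is_derive1_powR (- r) s1) (lin s).
apply: is_derive_eq (is_deriveZ (d * r)^-1 (is_deriveB H (is_derive_cst (1 : R) s 1))) _.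
rewrite (_ : 2 / (nu - 2) = r + 1); last by rewrite /r; field; rewrite gt_eqF.
rewrite opprD subr0 /GRing.scale/=; field.
by rewrite dN0 gt_eqF.
Qed.

End step_size.
End step.

(** * The barrier along a line *)

Section barrier.
Variables (R : realType) (n : nat) (C : set 'cV[R]_n) (h : 'cV[R]_n -> \bar R).
Variables (M nu : R).
Hypotheses (C_open : open C) (C_convex : convex_set C) (C_no_line : no_line C).
Hypothesis hker : barrier_kernel C M nu h.
Implicit Types x z u v : 'cV[R]_n.

Lemma grad_coordE (F : 'cV[R]_n -> \bar R) i :
  (fun z => grad F z i 0) = 'D_(evec R i) (fine \o F).
Proof. by apply/funext => z; rewrite mxE. Qed.

Lemma hess_coordE (F : 'cV[R]_n -> \bar R) i j :
  (fun z => hess F z i j) = 'D_(evec R j) ('D_(evec R i) (fine \o F)).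
Proof. by apply/funext => z; rewrite mxE grad_coordE. Qed.

Lemma barrier_differentiable x : C x -> differentiable (fine \o h) x.
Proof. by move=> Cx; have [+ _] := bk_C3 hker; exact. Qed.

Lemma barrier_grad_differentiable x i : C x ->
  differentiable (fun z => grad h z i 0) x.
Proof.
by move=> Cx; rewrite grad_coordE; have [_ /(_ (evec R i))[+ _]] := bk_C3 hker; exact.
Qed.

Lemma barrier_hess_differentiable x i j : C x ->
  differentiable (fun z => hess h z i j) x.
Proof.
move=> Cx; rewrite hess_coordE.
by have [_ /(_ (evec R i))[_ /(_ (evec R j))[+ _]]] := bk_C3 hker; exact.
Qed.

Lemma barrier_fin_num x : C x -> h x \is a fin_num.
Proof.
rewrite -(bk_domain hker) => hx; rewrite fin_numElt andbC hx/= ltNye.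
by have [+ _] := bk_proper hker; exact.
Qed.

Lemma is_derive_barrier x v t : C (x + t *: v) ->
  is_derive t 1 (fun s => fine (h (x + s *: v))) (dotv (grad h (x + t *: v)) v).
Proof.
move=> /barrier_differentiable hd.
by apply: is_derive_eq (is_derive_line hd) _; rewrite derive_dotv.
Qed.

Lemma is_derive_dotv_grad x v t : C (x + t *: v) ->
  is_derive t 1 (fun s => dotv (grad h (x + s *: v)) v)
    (dotv (hess h (x + t *: v) *m v) v).
Proof.
move=> Ct.
have hd i := is_deriveZ (v i 0) (is_derive_line (barrier_grad_differentiable i Ct)).
rewrite (_ : (fun s => _) =
    \sum_i (fun s => v i 0 *: grad h (x + s *: v) i 0)); last first.
  by apply/funext => s; rewrite fct_sumE dotvE; apply: eq_bigr => i _; rewrite mulrC.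
apply: is_derive_eq (is_derive_sum hd) _.
rewrite dotvE; apply: eq_bigr => i _; rewrite [LHS]mulrC; congr (_ * _).
rewrite derive_dotv; last exact: barrier_grad_differentiable.
rewrite dotvE mxE; apply: eq_bigr => j _; rewrite !mxE; congr (_ * _).
Qed.

Lemma is_derive_dotv_hess x v t : C (x + t *: v) ->
  is_derive t 1 (fun s => dotv (hess h (x + s *: v) *m v) v)
    (dotv (third_diff h (x + t *: v) v *m v) v).
Proof.
move=> Ct.
have hd i := is_deriveZ (v i 0) (is_derive_sum (fun j =>
  is_deriveZ (v j 0) (is_derive_line (barrier_hess_differentiable i j Ct)))).
rewrite (_ : (fun s => _) = \sum_i (v i 0 *:
    \sum_j (fun s => v j 0 *: hess h (x + s *: v) i j))); last first.
  apply/funext => s; rewrite fct_sumE dotvE; apply: eq_bigr => i _.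
  rewrite mulrC; congr (_ * _); rewrite mxE fct_sumE.
  by apply: eq_bigr => j _; rewrite mulrC.
apply: is_derive_eq (is_derive_sum hd) _.
rewrite dotvE; apply: eq_bigr => i _; rewrite [LHS]mulrC; congr (_ * _).
by rewrite mxE; apply: eq_bigr => j _; rewrite [LHS]mulrC mxE.
Qed.

(** Self-concordance at [u = v], with the factors grouped as in the one-variable comparison:
    [c = M |v|^(3 - nu)] and [q = nu - 2]. *)
Lemma third_diff_le x v : C x -> v != 0 ->
  `|dotv (third_diff h x v *m v) v| <= M * enorm v `^ (3 - nu) *
     Num.sqrt (dotv (hess h x *m v) v) ^+ 2 *
     Num.sqrt (dotv (hess h x *m v) v) `^ (nu - 2).
Proof.
move=> Cx v0; apply: (le_trans (bk_gsc hker v Cx v0)).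
by rewrite /local_norm mulrAC (mulrAC M).
Qed.

Let nu2 : 0 < nu - 2.
Proof. by rewrite subr_gt0; have /andP[] := bk_nu hker. Qed.

Let c_ge0 v : 0 <= M * enorm v `^ (3 - nu).
Proof. by rewrite mulr_ge0 ?powR_ge0// ltW// (bk_M hker). Qed.

(* If the Hessian is nonpositive in the direction [v] at [x], it is so along the
   whole ray, where [h] then stays below its tangent: the ray never leaves [C]. *)
Lemma ray_in_domain x v T : C x -> v != 0 ->
  dotv (hess h x *m v) v <= 0 -> 0 <= T -> C (x + T *: v).
Proof.
move=> Cx v0 phi0 T0; pose g0 := dotv (grad h x) v.
(* The bound is the tangent's largest possible value on the segment, independent of [t]. *)
apply: (@stay_in_domain _ _ _ h _ _ _ (fine (h x) + T * `|g0|)) => //.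
- exact: bk_domain hker.
- exact: bk_lsc hker.
move=> t /andP[t0 tT] Ct.
have Cs s : 0 <= s <= t -> C (x + s *: v) by exact: convex_line.
have phi_le0 s : 0 <= s <= t -> dotv (hess h (x + s *: v) *m v) v <= 0.
  move=> /andP[s0 st]; apply: (nonpositive_preserved s0 (c_ge0 v) nu2
      (phi := fun s => dotv (hess h (x + s *: v) *m v) v)
      (dphi := fun s => dotv (third_diff h (x + s *: v) v *m v) v)).
  - move=> r /andP[r0 rs]; apply: is_derive_dotv_hess; apply: Cs.
    by rewrite r0 (le_trans rs).
  - move=> r /andP[r0 rs]; apply: third_diff_le => //; apply: Cs.
    by rewrite r0 (le_trans rs).
  - by rewrite scale0r addr0.
have g_le s : 0 <= s <= t -> dotv (grad h (x + s *: v)) v <= g0.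
  move=> /andP[s0 st].
  have -> : g0 = dotv (grad h (x + 0 *: v)) v by rewrite scale0r addr0.
  apply: (le0_is_derive_le s0 (g := fun s => dotv (grad h (x + s *: v)) v)
    (dg := fun s => dotv (hess h (x + s *: v) *m v) v)).
    move=> r /andP[r0 rs]; apply: is_derive_dotv_grad; apply: Cs.
    by rewrite r0 (le_trans rs).
  by move=> r /andP[/ltW r0 /ltW rs]; apply: phi_le0; rewrite r0 (le_trans rs).
rewrite -(fineK (barrier_fin_num Ct)) lee_fin.
have : fine (h (x + t *: v)) - g0 * t <= fine (h (x + 0 *: v)) - g0 * 0.
  apply: (le0_is_derive_le t0 (g := fun s => fine (h (x + s *: v)) - g0 * s)
    (dg := fun s => dotv (grad h (x + s *: v)) v - g0)).
    move=> s st.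
    have := is_deriveB (is_derive_barrier (Cs _ st)) (is_deriveZ g0 (is_derive_id s 1)).
    by rewrite /GRing.scale/= mulr1.
  by move=> s /andP[/ltW s0 /ltW st]; rewrite subr_le0 g_le// s0.
rewrite scale0r addr0 mulr0 subr0 lerBlDr => /le_trans; apply.
by rewrite lerD2l (le_trans (ler_norm _))// normrM mulrC (ger0_norm t0) ler_wpM2r.
Qed.

Lemma hess_posdef x : C x -> posdef (hess h x).
Proof.
move=> Cx v v0; rewrite ltNge; apply/negP => phi0.
apply: C_no_line; exists x, v; split => // t.
have [t0|/ltW t0] := leP 0 t; first exact: ray_in_domain.
(* Negative [t] are reached along [- v], where the quadratic form has the same value. *)
rewrite -[t *: v]opprK -scaleNr -scalerN; apply: ray_in_domain => //.
- by rewrite oppr_eq0.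
- by rewrite -scaleN1r -scalemxAr dotvZl dotvZr !mulN1r opprK.
- by rewrite oppr_ge0.
Qed.

(** Two integrations: the second derivative is at most [lam^2 psi'], so the slope grows by at most
    [lam^2 psi(s) <= lam^2 s/(a K)], and [h] exceeds its tangent by at most [lam^2 t^2/(2 a K)]. *)
Lemma bregman_step x v a K psi
    (d := M * ((nu - 2) / 2) * local_norm h x v `^ (nu - 2) * enorm v `^ (3 - nu)) :
  C x -> v != 0 -> 0 < K -> 0 < a -> d * a < 1 ->
  step_profile (2 / (nu - 2)) K d a psi ->
  C (x + a *: v) /\
  bregman h (x + a *: v) x <= local_norm h x v ^+ 2 * a / (2 * K).
Proof.
move=> Cx v0 K0 a0 da prof; pose g0 := dotv (grad h x) v.
pose phi s := dotv (hess h (x + s *: v) *m v) v.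
have phi0E : local_norm h x v ^+ 2 = phi 0.
  by rewrite sqr_sqrtr /phi ?scale0r ?addr0// ltW// hess_posdef.
have phi0_ge0 : 0 <= phi 0 by rewrite -phi0E sqr_ge0.
have d0 : 0 <= d.
  by rewrite !mulr_ge0 ?powR_ge0 ?invr_ge0 ?ltW// (bk_M hker).
have dE : d = M * enorm v `^ (3 - nu) * ((nu - 2) / 2) * Num.sqrt (phi 0) `^ (nu - 2).
  by rewrite /d mulrAC (mulrAC M) /local_norm /phi scale0r addr0.
have [psi0 psia psi'] := prof.
have p0 : 0 <= 2 / (nu - 2) by rewrite divr_ge0// ltW.
clearbody d.
(* Membership of [x + t *: v] in [C] is assumed here; the resulting bound is then what keeps the
   whole segment up to [a] inside [C]. *)
have breg_le t : 0 <= t <= a -> C (x + t *: v) ->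
    fine (h (x + t *: v)) <= fine (h x) + g0 * t + phi 0 / (2 * a * K) * t ^+ 2.
  move=> /andP[t0 ta] Ct.
  have Cs s : 0 <= s <= t -> C (x + s *: v) by exact: convex_line.
  have phi_le s : 0 <= s <= t -> phi s <= phi 0 * (1 - d * s) `^ (- (2 / (nu - 2))).
    move=> /andP[s0 st].
    apply: (positive_growth s0 nu2 (phi := phi)
      (dphi := fun s => dotv (third_diff h (x + s *: v) v *m v) v) _ _ dE).
    - move=> r /andP[r0 rs]; apply: is_derive_dotv_hess; apply: Cs.
      by rewrite r0 (le_trans rs).
    - move=> r /andP[r0 rs]; apply: third_diff_le => //; apply: Cs.
      by rewrite r0 (le_trans rs).
    - move=> r /andP[r0 rs]; apply: hess_posdef => //; apply: Cs.
      by rewrite r0 (le_trans rs).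
    - by rewrite (le_lt_trans _ da)// ler_wpM2l// (le_trans st).
  have g_le s : 0 <= s <= t -> dotv (grad h (x + s *: v)) v <= g0 + phi 0 * (s / (a * K)).
    move=> /andP[s0 st].
    have : dotv (grad h (x + s *: v)) v - phi 0 * psi s <=
           dotv (grad h (x + 0 *: v)) v - phi 0 * psi 0.
      apply: (le0_is_derive_le s0
        (g := fun s => dotv (grad h (x + s *: v)) v - phi 0 * psi s)
        (dg := fun s => phi s - phi 0 * (1 - d * s) `^ (- (2 / (nu - 2))))).
        move=> r /andP[r0 rs].
        have rt : 0 <= r <= t by rewrite r0 (le_trans rs).
        have ra : 0 <= r <= a by rewrite r0 (le_trans rs)// (le_trans st).
        exact: is_deriveB (is_derive_dotv_grad (Cs _ rt))
          (is_deriveZ (phi 0) (psi' _ ra)).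
      by move=> r /andP[/ltW r0 /ltW rs]; rewrite subr_le0 phi_le// r0 (le_trans rs).
    rewrite psi0 mulr0 subr0 scale0r addr0 lerBlDr => /le_trans; apply.
    rewrite lerD2l ler_wpM2l// (step_profile_le prof)// s0 (le_trans st)//.
  have : fine (h (x + t *: v)) - (g0 * t + phi 0 / (2 * a * K) * t ^+ 2) <=
         fine (h (x + 0 *: v)) - (g0 * 0 + phi 0 / (2 * a * K) * 0 ^+ 2).
    apply: (le0_is_derive_le t0
      (g := fun s => fine (h (x + s *: v)) - (g0 * s + phi 0 / (2 * a * K) * s ^+ 2))
      (dg := fun s => dotv (grad h (x + s *: v)) v - (g0 + phi 0 * (s / (a * K))))).
      move=> s st.
      have H := is_deriveB (is_derive_barrier (Cs _ st))
        (is_deriveD (is_deriveZ g0 (is_derive_id s 1))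
          (is_deriveZ (phi 0 / (2 * a * K)) (is_deriveX 2 (is_derive_id s 1)))).
      apply: is_derive_eq H _; rewrite /GRing.scale/= !mulr1 expr1; congr (_ - (_ + _)).
      by field; rewrite !gt_eqF.
    by move=> s /andP[/ltW s0 /ltW st]; rewrite subr_le0 g_le// s0.
  by rewrite scale0r addr0 mulr0 expr0n/= mulr0 addr0 subr0 lerBlDr addrA.
have k0 : 0 <= phi 0 / (2 * a * K) by rewrite divr_ge0// !mulr_ge0// ltW.
have Ca : C (x + a *: v).
  apply: (@stay_in_domain _ _ _ h _ _ _
    (fine (h x) + `|g0| * a + phi 0 / (2 * a * K) * a ^+ 2)) => //.
  - exact: bk_domain hker.
  - exact: bk_lsc hker.
  - exact: ltW.
  move=> t ta Ct; rewrite -(fineK (barrier_fin_num Ct)) lee_fin.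
  apply: (le_trans (breg_le _ ta Ct)); case/andP: ta => t0 ta.
  rewrite lerD//; last by rewrite ler_wpM2l// lerXn2r// nnegrE// ltW.
  rewrite lerD2l (le_trans (ler_norm _))// normrM (ger0_norm t0).
  exact: ler_wpM2l.
split=> //; rewrite phi0E /bregman (addrAC x) subrr add0r dotvZr -/g0.
have := breg_le a; rewrite (ltW a0) lexx => /(_ isT Ca).
have -> : phi 0 / (2 * a * K) * a ^+ 2 = phi 0 * a / (2 * K).
  by field; rewrite !gt_eqF.
lra.
Qed.

End barrier.

(** * Descent and convergence *)

(** The test value [- S / (Q + 1)] makes the expression minus a square; the 1 covers [Q = 0]. *)
Lemma nonneg_quadratic (R : realFieldType) (S Q : R) : 0 <= Q ->
  (forall e, 0 <= e * S + e ^+ 2 * Q) -> S = 0.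
Proof.
move=> Q0 /(_ (- S / (Q + 1))).
have Q1 : 0 < Q + 1 by rewrite ltr_wpDl.
have -> : - S / (Q + 1) * S + (- S / (Q + 1)) ^+ 2 * Q = - (S / (Q + 1)) ^+ 2.
  by field; rewrite gt_eqF.
rewrite oppr_ge0 exprn_even_le0//= mulf_eq0 invr_eq0 (gt_eqF Q1) orbF.
by move/eqP.
Qed.

(** The product is homogeneous of degree one in [(l, t)]. According to the sign of [3 - r], the
    upper or the lower comparison of [t] with [l] applies; adding both constants covers the two
    cases. *)
Lemma powR_ratio_le (R : realType) (l t u k r : R) : 0 < l -> 0 < t ->
  0 < u -> 0 < k -> l <= u * t -> t <= k * l ->
  l `^ (r - 2) * t `^ (3 - r) <= l * (u `^ (r - 3) + k `^ (3 - r)).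
Proof.
move=> l0 t0 u0 k0 lut tkl.
rewrite mulrDr; have [r3|r3] := leP r 3.
  apply: (@le_trans _ _ (l * k `^ (3 - r))); last by rewrite lerDr mulr_ge0 ?powR_ge0 ?ltW.
  apply: (@le_trans _ _ (l `^ (r - 2) * (k * l) `^ (3 - r))).
    by rewrite ler_wpM2l ?powR_ge0// ge0_ler_powR ?nnegrE ?mulr_ge0 ?(ltW l0)
      ?(ltW t0) ?(ltW k0) ?subr_ge0.
  rewrite powRM ?(ltW k0) ?(ltW l0)// mulrCA -powRD ?(gt_eqF l0) ?implybT//.
  have -> : r - 2 + (3 - r) = 1 by ring.
  by rewrite powRr1 ?(ltW l0)// mulrC.
apply: (@le_trans _ _ (l * u `^ (r - 3))); last by rewrite lerDl mulr_ge0 ?powR_ge0 ?ltW.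
have -> : l `^ (r - 2) = l * l `^ (r - 3).
  rewrite -{2}[l]powRr1 ?(ltW l0)// -powRD ?(gt_eqF l0) ?implybT//.
  by congr (_ `^ _); ring.
have -> : 3 - r = - (r - 3) by rewrite opprB.
rewrite -mulrA ler_pM2l// powRN ler_pdivrMr ?powR_gt0//.
rewrite -powRM ?(ltW u0) ?(ltW t0)//.
rewrite ge0_ler_powR ?nnegrE ?mulr_ge0 ?(ltW l0) ?(ltW t0) ?(ltW u0)//.
by rewrite subr_ge0 ltW.
Qed.

Lemma cvg_sumr (R : realType) (I : finType) (T : Type) (F : set_system T)
    {FF : Filter F} (u : I -> T -> R) (l : I -> R) :
  (forall i, u i x @[x --> F] --> l i) ->
  \sum_i u i x @[x --> F] --> \sum_i l i.
Proof. by move=> ul; apply: cvg_big => //; exact: add_continuous. Qed.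

Lemma cvg_dotv (R : realType) n (T : Type) (F : set_system T) {FF : Filter F}
    (u : T -> 'cV[R]_n) (l v : 'cV[R]_n) :
  (forall i, u t i 0 @[t --> F] --> l i 0) ->
  dotv (u t) v @[t --> F] --> dotv l v.
Proof.
move=> ul; under eq_fun do rewrite dotvE; rewrite dotvE.
by apply: cvg_sumr => i; apply: cvgM; [exact: ul|exact: cvg_cst].
Qed.

Lemma cvg_mulmx_vec (R : realType) m n (T : Type) (F : set_system T) {FF : Filter F}
    (S : T -> 'M[R]_(m, n)) (S0 : 'M[R]_(m, n)) (v : 'cV[R]_n) i :
  (forall i j, S t i j @[t --> F] --> S0 i j) ->
  (S t *m v) i 0 @[t --> F] --> (S0 *m v) i 0.
Proof.
move=> SS0; under eq_fun do rewrite mxE; rewrite mxE.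
by apply: cvg_sumr => j; apply: cvgM; [exact: SS0|exact: cvg_cst].
Qed.

(** * The potential, the search direction and the descent of one step *)

Section hba_convergence.
Variables (R : realType) (m n : nat).
Variables (C : set 'cV[R]_n) (A : 'M[R]_(m, n)) (b : 'cV[R]_m).
Variables (f h : 'cV[R]_n -> \bar R) (M nu L mu : R).
Hypotheses (hpb : problem_data C A b f) (hker : barrier_kernel C M nu h).
Hypotheses (L0 : 0 < L) (hsmooth : L_smooth C f h L) (mu0 : 0 < mu).
Implicit Types x p v w : 'cV[R]_n.

Local Notation dir := (search_dir A f h mu).
Local Notation decr := (newton_decrement A f h mu).
Local Notation step := (step_size A f h M nu mu L).

(** A real-valued form of the potential, meaningful on [C], where both terms are finite; [fine]
    sends infinite values to 0. *)
Definition potential_real x : R := fine (f x) + mu * fine (h x).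
Local Notation pot := potential_real.

Definition potential_grad x := grad f x + mu *: grad h x.
Local Notation g := potential_grad.

Let K0 : 0 < L + mu. Proof. by rewrite addr_gt0. Qed.

Let posdefH x : C x -> posdef (hess h x).
Proof.
exact: (hess_posdef (pb_open hpb) (pb_convex hpb) (pb_no_line hpb) hker).
Qed.

Lemma near_domain p : C p -> \forall x \near p, C x.
Proof. by move=> Cp; apply: open_nbhs_nbhs; split => //; exact: pb_open hpb. Qed.

Lemma fine_potential x : C x -> fine (potential f h mu x) = pot x.
Proof.
move=> Cx; rewrite fineD ?fineM//.
- exact: barrier_fin_num hker _ Cx.
- exact: pb_finite hpb _ Cx.
- by rewrite fin_numM// (barrier_fin_num hker Cx).
Qed.

Lemma near_fine_potential p : C p ->
  \near p, ((fine \o f) + mu \*: (fine \o h)) p = (fine \o potential f h mu) p.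
Proof.
by move=> /near_domain; apply: filterS => x Cx; rewrite /= fine_potential.
Qed.

Lemma f_differentiable x : C x -> differentiable (fine \o f) x.
Proof. by move=> Cx; have [+ _] := pb_C1 hpb; exact. Qed.

Lemma pot_differentiable x : C x -> differentiable pot x.
Proof.
move=> Cx; apply: (@differentiableD _ _ _ (fine \o f) (mu \*: (fine \o h))).
  exact: f_differentiable.
exact/differentiableZ/(barrier_differentiable hker).
Qed.

Lemma grad_potential x : C x -> grad (potential f h mu) x = g x.
Proof.
move=> Cx; apply/colP => i; rewrite !mxE -(near_eq_derive _ (near_fine_potential Cx)).
have df := @diff_derivable _ _ _ _ _ (evec R i) (f_differentiable Cx).
have dh := @diff_derivable _ _ _ _ _ (evec R i) (barrier_differentiable hker Cx).
by rewrite (deriveD df (derivableZ (k := mu) dh)) (deriveZ mu dh).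
Qed.

Lemma has_grad_potential x : C x -> has_grad (potential f h mu) x.
Proof.
move=> Cx; split.
  apply: filterS (near_domain Cx) => y Cy.
  rewrite fin_numD fin_numM ?(barrier_fin_num hker Cy)// andbT.
  exact: pb_finite hpb _ Cy.
exact: near_eq_differentiable (near_fine_potential Cx) (pot_differentiable Cx).
Qed.


Lemma sqr_local_norm x v : C x -> local_norm h x v ^+ 2 = dotv (hess h x *m v) v.
Proof.
move=> Cx; rewrite sqr_sqrtr//.
by have [->|/(posdefH Cx)/ltW//] := eqVneq v 0; rewrite dotv0.
Qed.

(** Positive definiteness provides a minimiser, so [get] returns one and not its default value. *)
Lemma search_dir_argmin x : C x ->
  argmin [set v | A *m v = 0]
    (fun v => dotv (g x) v + 2^-1 * local_norm h x v ^+ 2) (dir x).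
Proof.
move=> Cx; rewrite -grad_potential//; apply: getPex.
rewrite (_ : (fun v => _ + _) = fun v => dotv (grad (potential f h mu) x) v +
    2^-1 * dotv (hess h x *m v) v).
  exact/posdef_argmin/posdefH.
by apply/funext => v; rewrite sqr_local_norm.
Qed.

(** Minimality is tested on the multiples [(1 + e) d] of the direction; the coefficient of [e] must
    vanish. *)
Lemma dotv_grad_search_dir x : C x -> dotv (g x) (dir x) = - decr x ^+ 2.
Proof.
move=> Cx; have [Ad dmin] := search_dir_argmin Cx.
apply/eqP; rewrite -addr_eq0; apply/eqP.
apply: (@nonneg_quadratic _ _ (2^-1 * decr x ^+ 2)).
  by rewrite mulr_ge0 ?sqr_ge0.
move=> e; have /= := dmin ((1 + e) *: dir x).
rewrite -scalemxAr Ad scaler0 => /(_ erefl).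
rewrite /newton_decrement !sqr_local_norm// -scalemxAr !dotvZl !dotvZr.
lra.
Qed.

Lemma search_dir_lower_bound x v : C x -> A *m v = 0 ->
  - (2^-1 * decr x ^+ 2) <= dotv (g x) v + 2^-1 * dotv (hess h x *m v) v.
Proof.
move=> Cx Av; have [Ad /(_ v Av)] := search_dir_argmin Cx.
rewrite dotv_grad_search_dir// -[local_norm h x (dir x)]/(decr x) sqr_local_norm//.
lra.
Qed.

(** Smoothness gives [F(y) <= F(x) + a <g, d> + (L + mu) D_h(y, x)]. The linear term is [- a lam^2]
    and the last one at most [a lam^2 / 2]. *)
Lemma hba_descent x : C x -> let y := x + step x *: dir x in
  [/\ C y, A *m y = A *m x & pot y <= pot x - step x * (2^-1 * decr x ^+ 2)].
Proof.
move=> Cx y; have [Ad _] := search_dir_argmin Cx.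
have Ay : A *m y = A *m x by rewrite mulmxDr -scalemxAr Ad scaler0 addr0.
have [d0|d0] := eqVneq (dir x) 0.
  rewrite /y /newton_decrement d0 scaler0 addr0; split=> //.
  by rewrite sqr_local_norm// dotv0 !mulr0 subr0.
have [a0 da [psi prof]] := step_size_profile A f h x (bk_M hker) (bk_nu hker) mu0 L0.
have dE : delta_mu A f h M nu mu x =
    M * ((nu - 2) / 2) * local_norm h x (dir x) `^ (nu - 2) * enorm (dir x) `^ (3 - nu).
  by rewrite /delta_mu (negPf d0).
rewrite dE in da prof.
have [Cy breg] := bregman_step (pb_open hpb) (pb_convex hpb) (pb_no_line hpb) hker
  Cx d0 K0 a0 da prof.
split=> //; have := hsmooth Cx Cy.
have := dotv_grad_search_dir Cx; rewrite /potential_grad dotvDl dotvZl => gd.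
move: breg; rewrite -/y /bregman => breg smooth.
have e v : dotv v (y - x) = step x * dotv v (dir x).
  by rewrite /y (addrAC x) subrr add0r dotvZr.
rewrite !e in breg smooth.
rewrite ler_pdivlMr ?mulr_gt0// -/(decr x) in breg.
rewrite /potential_real.
set fy := fine (f y) in smooth *; set fx := fine (f x) in smooth *.
set hy := fine (h y) in breg smooth *; set hx := fine (h x) in breg smooth *.
set a := step x in breg smooth a0 *.
set gf := dotv (grad f x) (dir x) in gd smooth.
set gh := dotv (grad h x) (dir x) in gd breg smooth.
set l2 := decr x ^+ 2 in gd breg *.
have gfE : gf = - l2 - mu * gh by rewrite -gd addrK.
rewrite gfE in smooth.
clear -breg smooth; lra.
Qed.

(** * Estimates uniform near a point of [C] *)

Lemma grad_continuous p i : C p -> g x i 0 @[x --> p] --> g p i 0.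
Proof.
move=> Cp.
have e y : g y i 0 = 'D_(evec R i) (fine \o f) y + mu * grad h y i 0.
  by rewrite /potential_grad !mxE.
rewrite e; under eq_fun do rewrite e; apply: (cvgD (F := nbhs p)).
  have [_ gc] := pb_C1 hpb; exact: (gc (evec R i) p Cp).
apply: (cvgM (F := nbhs p)); first exact: cvg_cst.
exact: differentiable_continuous (barrier_grad_differentiable hker i Cp).
Qed.

Lemma hess_continuous p i j : C p -> hess h x i j @[x --> p] --> hess h p i j.
Proof.
by move=> Cp; exact: differentiable_continuous (barrier_hess_differentiable hker i j Cp).
Qed.

Lemma near_local_norm_equiv p : C p -> exists2 k : R, 0 < k &
  \forall x \near p, forall v, local_norm h x v <= k * enorm v /\
    enorm v <= k * local_norm h x v.
Proof.
move=> Cp; have [K Kgt0 Kle] := posdef_coercive (posdefH Cp).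
pose N := \sum_i \sum_j `|hess h p i j|.
(* One constant dominates [N + 1], [2 * K] and 1; the last allows passing from [c^2 <= k d^2] to
   [c <= k d]. *)
pose k := N + 1 + 2 * K + 1.
have N0 : 0 <= N by apply: sumr_ge0 => i _; exact: sumr_ge0.
have k1 : 1 <= k by rewrite lerDr !addr_ge0 ?mulr_ge0 ?(ltW Kgt0).
have k0 : 0 < k by rewrite (lt_le_trans _ k1).
exists k => //.
have up : \forall x \near p, \sum_i \sum_j `|hess h x i j| <= N + 1.
  have cv : \sum_i \sum_j `|hess h x i j| @[x --> p] --> N.
    apply: (cvg_sumr (F := nbhs p)) => i; apply: (cvg_sumr (F := nbhs p)) => j.
    by apply: (cvg_norm (F := nbhs p)); exact: hess_continuous.
  by move/cvgr_le : cv; apply; rewrite ltrDl.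
have lo : \forall x \near p, \sum_i \sum_j `|hess h p i j - hess h x i j| <= (2 * K)^-1.
  have cv : \sum_i \sum_j `|hess h p i j - hess h x i j| @[x --> p] -->
      \sum_i \sum_j `|hess h p i j - hess h p i j|.
    apply: (cvg_sumr (F := nbhs p)) => i; apply: (cvg_sumr (F := nbhs p)) => j.
    apply: (cvg_norm (F := nbhs p)); apply: (cvgB (F := nbhs p)); first exact: cvg_cst.
    exact: hess_continuous.
  move/cvgr_le : cv; apply; rewrite big1 ?invr_gt0 ?mulr_gt0// => i _.
  by rewrite big1// => j _; rewrite subrr normr0.
near=> x => v.
have Cx : C x by near: x; exact: near_domain.
have upx : \sum_i \sum_j `|hess h x i j| <= N + 1 by near: x.
have lox : \sum_i \sum_j `|hess h p i j - hess h x i j| <= (2 * K)^-1 by near: x.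
have sqr_le (c d : R) : 0 <= c -> 0 <= d -> c ^+ 2 <= k * d ^+ 2 -> c <= k * d.
  move=> c0 d0 cd; rewrite -(@ler_pXn2r _ 2) ?nnegrE ?(mulr_ge0 (ltW k0))// exprMn.
  by rewrite (le_trans cd)// ler_wpM2r ?sqr_ge0// expr2 ler_peMl// ltW.
have lE : local_norm h x v ^+ 2 = dotv (hess h x *m v) v := sqr_local_norm v Cx.
split; (apply: sqr_le; [exact: sqrtr_ge0|exact: sqrtr_ge0|]); rewrite lE.
  apply: (le_trans (ler_norm _)); apply: (le_trans (quad_le _ _)).
  rewrite ler_wpM2r ?sqr_ge0// (le_trans upx)//.
  by rewrite /k -addrA lerDl addr_ge0 ?mulr_ge0 ?(ltW Kgt0).
apply: (le_trans (coercive_perturbation Kgt0 (Kle v) lox)).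
by rewrite ler_wpM2r -?lE ?sqr_ge0// /k; lra.
Unshelve. all: by end_near. Qed.

(** Near [p] delta is at most a constant times [lam], and [lam] is bounded since
    [lam^2 = - <g, d> <= G |d| <= G k lam]. *)
Lemma near_delta_mu_le p : C p -> exists2 D : R, 0 < D &
  \forall x \near p, 0 <= delta_mu A f h M nu mu x <= D.
Proof.
move=> Cp; have [k k0 near_k] := near_local_norm_equiv Cp.
pose G := \sum_i `|g p i 0| + 1.
have G0 : 0 < G by rewrite ltr_wpDl// sumr_ge0.
have near_G : \forall x \near p, \sum_i `|g x i 0| <= G.
  have cv : \sum_i `|g x i 0| @[x --> p] --> \sum_i `|g p i 0|.
    apply: (cvg_sumr (F := nbhs p)) => i; apply: (cvg_norm (F := nbhs p)).
    exact: grad_continuous.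
  by move/cvgr_le : cv; apply; rewrite ltrDl.
have nu2 : 0 < nu - 2 by rewrite subr_gt0; have /andP[] := bk_nu hker.
pose B := k `^ (nu - 3) + k `^ (3 - nu).
have B0 : 0 < B by rewrite addr_gt0 ?powR_gt0.
pose D := M * ((nu - 2) / 2) * (k * G * B).
have c0 : 0 < M * ((nu - 2) / 2) by rewrite mulr_gt0 ?divr_gt0// (bk_M hker).
have D0 : 0 < D by rewrite mulr_gt0// !mulr_gt0.
exists D => //; near=> x.
rewrite delta_mu_ge0 ?(bk_M hker) ?(bk_nu hker)//=.
have Cx : C x by near: x; exact: near_domain.
have Gx : \sum_i `|g x i 0| <= G by near: x.
have kx : forall v, local_norm h x v <= k * enorm v /\ enorm v <= k * local_norm h x v.
  by near: x.
rewrite /delta_mu; case: ifPn => [_|d0]; first exact: ltW.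
have [lk bk] := kx (dir x).
have b0 : 0 < dir_norm A f h mu x by rewrite enorm_gt0.
have l0 : 0 < decr x.
  by have := lt_le_trans b0 bk; rewrite pmulr_rgt0.
rewrite -mulrA ler_pM2l//.
apply: (le_trans (powR_ratio_le _ l0 b0 k0 k0 lk bk)).
rewrite ler_pM2r//.
have : decr x ^+ 2 <= G * (k * decr x).
  rewrite -[_ ^+ 2]opprK -dotv_grad_search_dir// (le_trans (ler_norm _))// normrN.
  apply: (@le_trans _ _ (G * dir_norm A f h mu x)); last by rewrite ler_pM2l.
  rewrite dotvE (le_trans (ler_norm_sum _ _ _))//.
  apply: (@le_trans _ _ (\sum_i `|g x i 0| * dir_norm A f h mu x)).
    apply: ler_sum => i _; rewrite normrM ler_wpM2l//; exact: coord_le_enorm.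
  by rewrite -mulr_suml ler_wpM2r// ltW.
by rewrite mulrA expr2 ler_pM2r// mulrC.
Unshelve. all: by end_near. Qed.

Lemma near_step_size_ge p : C p -> exists2 a0 : R, 0 < a0 &
  \forall x \near p, a0 <= step x.
Proof.
move=> Cp; have [D D0 near_D] := near_delta_mu_le Cp.
exists (Num.min (2 * D)^-1 ((L + mu) * 2 `^ (2 / (nu - 2)))^-1).
  by rewrite lt_min !invr_gt0 !mulr_gt0 ?powR_gt0.
apply: filterS near_D => x dD.
have [a0 _ [psi prof]] := step_size_profile A f h x (bk_M hker) (bk_nu hker) mu0 L0.
apply: (step_profile_lower_bound prof) => //.
by rewrite divr_ge0// subr_ge0 ltW//; have /andP[] := bk_nu hker.
Qed.

(** For the fixed [v], continuity keeps the model below [q / 2] near [p]. Its minimum [- lam^2 / 2]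
    is lower still, so a step of length at least [a0] gains at least [a0 * (- (q / 2))]. *)
Lemma near_uniform_decrease p v : C p -> A *m v = 0 ->
  dotv (g p) v + 2^-1 * dotv (hess h p *m v) v < 0 ->
  exists2 e : R, 0 < e &
    \forall x \near p, C x /\ pot (x + step x *: dir x) <= pot x - e.
Proof.
move=> Cp Av; set q := _ + _ => q0.
have [a0 a0_gt0 near_a] := near_step_size_ge Cp.
have cq : dotv (g x) v + 2^-1 * dotv (hess h x *m v) v @[x --> p] --> q.
  apply: (cvgD (F := nbhs p)).
    by apply: (cvg_dotv (F := nbhs p)) => i; exact: grad_continuous.
  apply: (cvgM (F := nbhs p)); first exact: cvg_cst.
  apply: (cvg_dotv (F := nbhs p)) => i; apply: (cvg_mulmx_vec (F := nbhs p)).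
  by move=> {}i j; exact: hess_continuous.
have near_q : \forall x \near p,
    dotv (g x) v + 2^-1 * dotv (hess h x *m v) v <= q / 2.
  by move/cvgr_le : cq; apply; lra.
have e0 : 0 < a0 * (- (q / 2)) by rewrite mulr_gt0//; lra.
exists (a0 * (- (q / 2))) => //; near=> x.
have Cx : C x by near: x; exact: near_domain.
split=> //; have [_ _ /le_trans->//] := hba_descent Cx.
rewrite lerD2l lerN2; apply: ler_pM; [exact: ltW|lra|by near: x|].
have : dotv (g x) v + 2^-1 * dotv (hess h x *m v) v <= q / 2 by near: x.
have := search_dir_lower_bound Cx Av; lra.
Unshelve. all: by end_near. Qed.

End hba_convergence.

(** * Stationarity of the accumulation points *)

Theorem theorem5p6 (R : realType) (m n : nat)
    (C : set 'cV[R]_n) (A : 'M[R]_(m, n)) (b : 'cV[R]_m)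
    (f h : 'cV[R]_n -> \bar R) (M nu L mu c : R) (x : nat -> 'cV[R]_n)
    (hpb : problem_data C A b f)
    (hker : barrier_kernel C M nu h)
    (hL : 0 < L) (hsmooth : L_smooth C f h L)
    (hmu : 0 < mu) (hc : 0 < c)
    (hx0 : analytic_center C A b h c (x 0%N))
    (hx : hba_sequence A f h M nu mu L x) :
  omega_limit (feasible C A b) x `<=`
    [set p | feasible C A b p /\ has_grad (potential f h mu) p /\
       exists y : 'cV[R]_m, grad (potential f h mu) p - A^T *m y = 0].
Proof.
have xC k : C (x k).
  elim: k => [|k IH]; first by have [[]] := hx0.
  by rewrite hx; have [] := hba_descent hpb hker hL hsmooth hmu IH.
pose P := potential_real f h mu.
have P_step k : P (x k.+1) <= P (x k).
  rewrite hx; have [_ _ /le_trans->//] := hba_descent hpb hker hL hsmooth hmu (xC k).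
  have [a0 _ _] := step_size_profile A f h (x k) (bk_M hker) (bk_nu hker) hmu hL.
  by rewrite gerBl mulr_ge0 ?(ltW a0)// mulr_ge0 ?sqr_ge0.
have P_decr i j : (i <= j)%N -> P (x j) <= P (x i).
  move=> /subnK <-; elim: (j - i)%N => [//|k IH].
  by rewrite addSn (le_trans (P_step _)).
move=> p [Xp [k [k_incr xkp]]]; split=> //.
have Cp : C p.
  rewrite -(bk_domain hker) /domain/= ltey; apply/negP => /eqP hp.
  (* At this stage [p] is only known to be in the closure of [C], so [f p] may be infinite; a real
     number below it suffices. *)
  have [a af] : exists a : R, (a%:E < f p)%E.
    have [+ _] := pb_proper hpb => /(_ p).
    case: (f p) => [r _|_|//]; last by exists 0; exact: ltry.
    by exists (r - 1); rewrite lte_fin gtrBl.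
  (* Chosen so that [a + mu * r = P (x 0)]: an iterate with [f > a] and [h > r] would exceed the
     initial potential. *)
  pose r := (P (x 0%N) - a) / mu.
  have [V1 V1p V1f] := pb_lsc hpb af.
  have [V2 V2p V2h] : exists2 V, nbhs p V & forall y, V y -> (r%:E < h y)%E.
    by apply: (bk_lsc hker); rewrite hp ltry.
  have : \forall q \near \oo, V1 (x (k q)) /\ V2 (x (k q)).
    by apply: filterI; exact: xkp.
  move=> /filter_ex[q [/V1f fq /V2h hq]].
  have := P_decr 0%N (k q) (leq0n _); rewrite leNgt => /negP; apply.
  rewrite -(fineK (pb_finite hpb (xC _))) lte_fin in fq.
  rewrite -(fineK (barrier_fin_num hker (xC _))) lte_fin in hq.
  rewrite {2}/P /potential_real.
  have -> : P (x 0%N) = a + mu * r by rewrite /r mulrCA divff ?mulr1 ?subrKC// gt_eqF.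
  by rewrite ltrD// ltr_pM2l.
split; first exact: (has_grad_potential mu hpb hker Cp).
rewrite (grad_potential mu hpb hker Cp); apply: dotv_ker_range.
set g := potential_grad f h mu p.
have q_ge0 v : A *m v = 0 -> 0 <= dotv g v + 2^-1 * dotv (hess h p *m v) v.
  move=> Av; rewrite leNgt; apply/negP.
  move=> /(near_uniform_decrease hpb hker hL hsmooth hmu Cp Av)[e e0 near_e].
  have cP : P y @[y --> p] --> P p.
    exact: differentiable_continuous (pot_differentiable mu hpb hker Cp).
  have near_P : \forall y \near p, `|P p - P y| < e / 2.
    by move/cvgrPdist_lt : cP; apply; rewrite divr_gt0.
  have [N _ near_x] : \forall q \near \oo,
      P (x (k q).+1) <= P (x (k q)) - e /\ `|P p - P (x (k q))| < e / 2.
    have decr_k : \forall q \near \oo, P (x (k q).+1) <= P (x (k q)) - e.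
      have near_e' : \forall y \near p,
          P (y + step_size A f h M nu mu L y *: search_dir A f h mu y) <= P y - e.
        by apply: filterS near_e => y [].
      have := xkp _ near_e'; rewrite /= /nbhs/=.
      by apply: filterS => q; rewrite hx.
    exact: filterI decr_k (xkp _ near_P).
  (* Visits [N] and [N.+1] both have potential within [e / 2] of [P p], yet the step after the first
     already lowers it by [e]. *)
  have [dN] := near_x N (leqnn N); rewrite ltr_norml => /andP[PN1 _].
  have [_] := near_x N.+1 (leqnSn N); rewrite ltr_norml => /andP[_ PN2].
  have : P (x (k N.+1)) <= P (x (k N).+1).
    (* [increasing_seq] is an equivalence of the two orders, so [k] is strictly increasing and
       [(k N).+1 <= k N.+1]. *)
    apply: P_decr; rewrite ltnNge.
    by have := k_incr N.+1 N; rewrite !leEnat ltnn => ->.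
  lra.
(* Scaling [v] by [e] turns nonnegativity of the model into vanishing of its linear part, so the
   gradient is orthogonal to the kernel of [A]. *)
move=> v Av; apply: (@nonneg_quadratic _ _ (2^-1 * dotv (hess h p *m v) v)).
  rewrite mulr_ge0//; have [->|v0] := eqVneq v 0; first by rewrite dotv0.
  exact/ltW/(hess_posdef (pb_open hpb) (pb_convex hpb) (pb_no_line hpb) hker).
move=> e; have := q_ge0 (e *: v); rewrite -!scalemxAr Av scaler0 => /(_ erefl).
rewrite dotvZl !dotvZr; lra.
Qed.
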